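(* Let $(\mathcal{M}^{\pm},g^{\pm})$ be two $n$-dimensional $C^2$ oriented spacetimes with $C^3$ boundaries $\Sigma^\pm$, identified with an abstract $C^3$ manifold $\Sigma$ so that the two first fundamental forms inherited by $\Sigma$ coincide ($h^+=h^-=:h$), and assume that there exist $C^2$ riggings $\vec\ell_\pm$ on $\Sigma^\pm$ satisfying the rigging conditions, so that a glued bulk $\mathcal{M}=\mathcal{M}^+\cup\mathcal{M}^-$ with continuous metric $g$ and brane $\Sigma$ is obtained. Let $\mathcal{G}_{\mu\nu}$ be the singular part on $\Sigma$ of the Einstein tensor distribution of $g$, and $\mathcal{G}_{ab}=e_a{}^\mu e_b{}^\nu\mathcal{G}_{\mu\nu}$ its tangential components. If $\mathcal{G}_{ab}=\beta\, h_{ab}$ for a function $\beta$ which is non-zero everywhere on $\Sigma$, then $\Sigma$ cannot change its causal character, i.e. its signature-changing set $S$ is empty.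
   Context: A $C^2$ spacetime with boundary is a $C^3$ manifold with $C^3$ boundary endowed with a $C^2$ Lorentzian metric (signature $(-,+,\dots,+)$). Gluing: there are $C^3$ embeddings $\Phi_\pm:\Sigma\to\mathcal{M}^\pm$ with $\Phi_\pm(\Sigma)=\Sigma^\pm$; $h^\pm=\Phi_\pm^\star(g^\pm)$; for local coordinates $\xi^a$ on $\Sigma$, $\vec e_a^{\,\pm}=d\Phi_\pm(\partial/\partial\xi^a)$. Rigging conditions: $\vec\ell_\pm$ are $C^2$ vector fields along $\Sigma^\pm$, nowhere tangent to $\Sigma^\pm$, with $\vec\ell_+$ pointing towards $\mathcal{M}^+$ and $\vec\ell_-$ pointing outwards from $\mathcal{M}^-$, and such that at corresponding points $g^+(\vec\ell_+,\vec\ell_+)=g^-(\vec\ell_-,\vec\ell_-)$ and $g^+(\vec\ell_+,\vec e_a^{\,+})=g^-(\vec\ell_-,\vec e_a^{\,-})$ for all $a$. Then the points of $\Sigma^\pm$ and the tangent spaces are identified ($\vec e_a=\vec e_a^{\,+}=\vec e_a^{\,-}$, $\vec\ell=\vec\ell_+=\vec\ell_-$), and $\mathcal{M}=\mathcal{M}^+\cup\mathcal{M}^-$ has a $C^3$ structure and a continuous metric $g$ equal to $g^\pm$ on $\mathcal{M}^\pm$. Normal: $\boldsymbol n$ is the one-form along $\Sigma$ with $n_\mu e_a{}^\mu=0$ and $n_\mu\ell^\mu=1$; $n^\mu=g^{\mu\nu}n_\nu$. Singular part of the Einstein tensor: put $\Pi^\alpha{}_\mu=\delta^\alpha_\mu-n_\mu\ell^\alpha$,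 $\mathcal{H}^\pm_{\mu\nu}=\Pi^\alpha{}_\mu\Pi^\beta{}_\nu\nabla^\pm_\alpha\ell_\beta|_\Sigma$ ($\nabla^\pm$ the Levi-Civita connection of $g^\pm$; only tangential derivatives of $\vec\ell$ enter), and $[\mathcal{H}_{\mu\nu}]=\mathcal{H}^+_{\mu\nu}-\mathcal{H}^-_{\mu\nu}$, which is symmetric. The Einstein tensor of $g$, as a distribution, has a part proportional to a Dirac delta supported on $\Sigma$ with coefficient $$\mathcal{G}_{\mu\nu}=n^\alpha[\mathcal{H}_{\alpha\mu}]n_\nu+n^\alpha[\mathcal{H}_{\alpha\nu}]n_\mu-n^\alpha n_\alpha[\mathcal{H}_{\mu\nu}]-n_\mu n_\nu[\mathcal{H}^\alpha{}_\alpha]-g_{\mu\nu}\big(n^\alpha n^\beta[\mathcal{H}_{\alpha\beta}]-n^\alpha n_\alpha[\mathcal{H}^\beta{}_\beta]\big).$$ (Replacing $\vec\ell$ by $A^{-1}\vec\ell$ multiplies $\mathcal{G}_{\mu\nu}$ by $A$.) Causal character: with $(\boldsymbol n,\boldsymbol n)=g^{\mu\nu}n_\mu n_\nu$, let $\Sigma_E$, $\Sigma_0$, $\Sigma_L$ be the subsets of $\Sigma$ where $(\boldsymbol n,\boldsymbol n)<0$, $=0$, $>0$ respectively. The signature-changing set is $S=(\overline{\Sigma_L}\cap\Sigma_0)\cup(\overline{\Sigma_E}\cap\Sigma_0)$ (closures in $\Sigma$). *)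

(* Defs.v *)
From HB Require Import structures.
From mathcomp Require Import all_boot all_order all_algebra.
From mathcomp Require Import all_classical all_reals all_analysis.
Set Implicit Arguments.
Unset Strict Implicit.
Unset Printing Implicit Defensive.
Import Order.TTheory GRing.Theory Num.Theory.
Import numFieldNormedType.Exports.
Local Open Scope classical_set_scope.
Local Open Scope ring_scope.

(* Vectors of R^n are row vectors. The Jacobian of f is J i j = d f^j / d x^i,*)
(* so that vectors transform by v |-> v *m J and bilinear forms pull back by  *)
(* g |-> J *m g *m J^T.                                                       *)

Section Calculus.
Variables (R : realType) (n : nat).
Implicit Types (D : set 'rV[R]_n) (x : 'rV[R]_n).

(* The increment t is restricted to x + t e_i \in D, so that at a boundary    *)
(* point of a half space the transverse derivative is the one-sided one.      *)
Definition pquot (f : 'rV[R]_n -> R) (i : 'I_n) x (t : R) : R :=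
  t^-1 * (f (x + t *: delta_mx 0 i) - f x).

Definition pnbhs D (i : 'I_n) x : set_system R :=
  within [set t | D (x + t *: delta_mx 0 i)] (0 : R)^'.

Definition partial D (f : 'rV[R]_n -> R) (i : 'I_n) x : R :=
  lim (pquot f i x @ pnbhs D i x).

(* C^k on D, where D is relatively open in R^n or in a half space of R^n.     *)
Fixpoint Ck (k : nat) D (f : 'rV[R]_n -> R) : Prop :=
  {within D, continuous f} /\
  match k with
  | 0%N => True
  | k'.+1 => forall i : 'I_n,
      (forall x, D x -> cvg (pquot f i x @ pnbhs D i x)) /\
      Ck k' D (partial D f i)
  end.

Definition Ck_vec p (k : nat) D (f : 'rV[R]_n -> 'rV[R]_p) : Prop :=
  forall j, Ck k D (fun x => f x 0 j).

Definition Ck_mx p q (k : nat) D (f : 'rV[R]_n -> 'M[R]_(p, q)) : Prop :=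
  forall i j, Ck k D (fun x => f x i j).

Definition jac p D (f : 'rV[R]_n -> 'rV[R]_p) x : 'M[R]_(n, p) :=
  \matrix_(i, j) partial D (fun y => f y 0 j) i x.

End Calculus.

Definition half_space (R : realType) (m : nat) : set 'rV[R]_m.+1 :=
  [set x | 0 <= x 0 0].

Section Manifolds.
Variables (R : realType) (n : nat) (H : set 'rV[R]_n).

(* H is the local model: setT, or a half space for manifolds with boundary.   *)
Record chart (M : topologicalType) := Chart {
  dom : set M;
  coord : M -> 'rV[R]_n;
  coordV : 'rV[R]_n -> M;
  dom_open : open dom;
  img_open : exists2 U : set 'rV[R]_n, open U & coord @` dom = U `&` H;
  coordK : forall x, dom x -> coordV (coord x) = x;
  coord_cont : {within dom, continuous coord};
  coordV_cont : {within coord @` dom, continuous coordV}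
}.

Definition img (M : topologicalType) (c : chart M) : set 'rV[R]_n :=
  coord c @` dom c.

Definition overlap (M : topologicalType) (c c' : chart M) : set 'rV[R]_n :=
  [set x | img c x /\ dom c' (coordV c x)].

Definition transition (M : topologicalType) (c c' : chart M)
    : 'rV[R]_n -> 'rV[R]_n :=
  coord c' \o coordV c.

Definition jac_transition (M : topologicalType) (c c' : chart M) (p : M)
    : 'M[R]_n :=
  jac (overlap c c') (transition c c') (coord c p).

Record C3_manifold := C3Manifold {
  points :> topologicalType;
  atlas : set (chart points);
  manifold_hausdorff : hausdorff_space points;
  manifold_second_countable : @second_countable points;
  atlas_cover : forall p : points, exists2 c, atlas c & dom c p;
  atlas_compat : forall c c', atlas c -> atlas c' ->
    Ck_vec 3 (overlap c c') (transition c c')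
}.

(* An orientation assigns a sign to every chart at every point of its domain; *)
(* a single oriented atlas of half-space charts need not exist when n = 1.    *)
Record orientation (M : C3_manifold) := Orientation {
  orient : chart M -> M -> bool;
  orient_loc_const : forall (c : chart M) (p : M), atlas c -> dom c p ->
    \forall q \near p, orient c q = orient c p;
  orient_compat : forall (c c' : chart M) (p : M),
    atlas c -> atlas c' -> dom c p -> dom c' p ->
    (orient c p == orient c' p) = (0 < \det (jac_transition c c' p))
}.

End Manifolds.

Definition boundary (R : realType) (m : nat)
    (M : C3_manifold (@half_space R m)) : set M :=
  [set p | exists c : chart (@half_space R m) M,
             [/\ atlas c, dom c p & coord c p 0 0 = 0]].

Definition minkowski (R : realType) (m : nat) : 'M[R]_(1 + m) :=
  block_mx (- 1%:M) 0 0 1%:M.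

Definition lorentzian (R : realType) (m : nat) (g : 'M[R]_(1 + m)) : Prop :=
  exists2 P : 'M[R]_(1 + m), P \in unitmx & g = P *m minkowski R m *m P^T.

(* metric c x is the matrix of components of the metric in the chart c at the *)
(* point of coordinates x.                                                    *)
Record spacetime (R : realType) (m : nat) := Spacetime {
  manifold_of :> C3_manifold (@half_space R m);
  oriented : orientation manifold_of;
  metric : chart (@half_space R m) manifold_of ->
           'rV[R]_(1 + m) -> 'M[R]_(1 + m);
  metric_C2 : forall c, atlas c -> Ck_mx 2 (img c) (metric c);
  metric_lorentzian : forall c x, atlas c -> img c x -> lorentzian (metric c x);
  metric_tensor : forall c c' (p : manifold_of),
    atlas c -> atlas c' -> dom c p -> dom c' p ->
    metric c (coord c p) =
      jac_transition c c' p *m metric c' (coord c' p)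
        *m (jac_transition c c' p)^T
}.

(* Levi-Civita connection: christoffel c x mu rho sigma = Gamma^mu_{rho sigma}*)
Definition christoffel (R : realType) (m : nat) (M : spacetime R m)
    (c : chart (@half_space R m) M) (x : 'rV[R]_(1 + m))
    (mu rho sigma : 'I_(1 + m)) : R :=
  let dg i j k := partial (img c) (fun y => metric c y j k) i x in
  2^-1 * \sum_nu invmx (metric c x) mu nu *
           (dg rho nu sigma + dg sigma nu rho - dg nu rho sigma).

Section OneSide.
Variables (R : realType) (m : nat).
Variables (Sigma : C3_manifold (@setT 'rV[R]_m)) (M : spacetime R m).
Local Notation schart := (chart (@setT 'rV[R]_m) Sigma).
Local Notation mchart := (chart (@half_space R m) M).
Implicit Types (s : schart) (c : mchart) (p : Sigma).

Variable Phi : Sigma -> M.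

Definition adapted s c p : Prop :=
  [/\ atlas s, atlas c, dom s p & dom c (Phi p)].

Definition local_dom s c : set 'rV[R]_m :=
  [set xi | img s xi /\ dom c (Phi (coordV s xi))].

Definition local_rep s c (xi : 'rV[R]_m) : 'rV[R]_(1 + m) :=
  coord c (Phi (coordV s xi)).

(* The a-th row is e_a = dPhi (d / d xi^a) in the coordinates of c.           *)
Definition tangents s c p : 'M[R]_(m, 1 + m) :=
  jac (local_dom s c) (local_rep s c) (coord s p).

Definition C3_embedding : Prop :=
  [/\ continuous Phi,
      injective Phi,
      (forall U : set Sigma, open U ->
         exists2 V : set M, open V & Phi @` U = V `&` range Phi),
      (forall s c, atlas s -> atlas c ->
         Ck_vec 3 (local_dom s c) (local_rep s c)) &
      (forall s c p, adapted s c p -> row_free (tangents s c p))].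

Definition metric_at c p : 'M[R]_(1 + m) := metric c (coord c (Phi p)).

Definition first_form s c p : 'M[R]_m :=
  tangents s c p *m metric_at c p *m (tangents s c p)^T.

(* l c p is the row of components of the vector l(p) of T_{Phi p} M.          *)
Variable l : mchart -> Sigma -> 'rV[R]_(1 + m).

Definition C2_field_along : Prop :=
  (forall c c' p, atlas c -> atlas c' -> dom c (Phi p) -> dom c' (Phi p) ->
     l c' p = l c p *m jac_transition c c' (Phi p)) /\
  (forall s c, atlas s -> atlas c ->
     Ck_vec 2 (local_dom s c) (fun xi => l c (coordV s xi))).

Definition nowhere_tangent : Prop :=
  forall s c p, adapted s c p -> ~~ (l c p <= tangents s c p)%MS.

Definition points_inwards : Prop :=
  forall c p, atlas c -> dom c (Phi p) -> 0 < l c p 0 0.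

Definition points_outwards : Prop :=
  forall c p, atlas c -> dom c (Phi p) -> l c p 0 0 < 0.

Definition rigging_norm c p : R := (l c p *m metric_at c p *m (l c p)^T) 0 0.

Definition rigging_tangent s c p : 'rV[R]_m :=
  l c p *m metric_at c p *m (tangents s c p)^T.

(* The basis (l, e_1, ..., e_m) of T_{Phi p} M, as rows.                      *)
Definition frame s c p : 'M[R]_(1 + m) := col_mx (l c p) (tangents s c p).

Definition frame_metric s c p : 'M[R]_(1 + m) :=
  frame s c p *m metric_at c p *m (frame s c p)^T.

(* The a-th row is the covariant derivative of l along e_a:                   *)
(* d l^mu / d xi^a + Gamma^mu_{rho sigma} e_a^rho l^sigma.                    *)
Definition nabla_rigging s c p : 'M[R]_(m, 1 + m) :=
  jac (local_dom s c) (fun xi => l c (coordV s xi)) (coord s p) +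
  \matrix_(a, mu) \sum_rho \sum_sigma
    christoffel c (coord c (Phi p)) mu rho sigma
      * tangents s c p a rho * l c p 0 sigma.

End OneSide.

(* At a point of Sigma the tangent spaces of the two sides are identified by  *)
(* l_+ = l_-, e_a^+ = e_a^-. Tensors on the identified tangent space are      *)
(* written in its basis (l, e_1, ..., e_m), l being the 0-th vector.          *)
Section GluedTangentSpace.
Variables (R : realType) (m : nat).

Definition rigging_vec : 'rV[R]_(1 + m) := row_mx 1 0.
Definition tangent_vecs : 'M[R]_(m, 1 + m) := row_mx 0 1%:M.

(* The one-form with n(l) = 1 and n(e_a) = 0.                                 *)
Definition normal_form : 'rV[R]_(1 + m) := row_mx 1 0.

(* proj alpha mu = delta^alpha_mu - n_mu l^alpha                              *)
Definition proj : 'M[R]_(1 + m) := 1%:M - rigging_vec^T *m normal_form.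

(* n^mu = g^{mu nu} n_nu                                                      *)
Definition normal_vec (g : 'M[R]_(1 + m)) (mu : 'I_(1 + m)) : R :=
  \sum_nu invmx g mu nu * normal_form 0 nu.

(* n^alpha n_alpha                                                            *)
Definition normal_norm (g : 'M[R]_(1 + m)) : R :=
  \sum_mu normal_vec g mu * normal_form 0 mu.

Definition trace_of (g h : 'M[R]_(1 + m)) : R :=
  \sum_alpha \sum_beta invmx g alpha beta * h alpha beta.

(* h is the jump [H] and g the metric.                                        *)
Definition einstein_of_jump (g h : 'M[R]_(1 + m)) : 'M[R]_(1 + m) :=
  let n := normal_form 0 in
  let nv := normal_vec g in
  \matrix_(mu, nu)
    ((\sum_alpha nv alpha * h alpha mu) * n nu
     + (\sum_alpha nv alpha * h alpha nu) * n mu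
     - normal_norm g * h mu nu
     - n mu * n nu * trace_of g h
     - g mu nu * (\sum_alpha \sum_beta nv alpha * nv beta * h alpha beta
                  - normal_norm g * trace_of g h)).

Variables (Sigma : C3_manifold (@setT 'rV[R]_m)).

(* (nabla_alpha l_beta): the row of the transverse derivative of l, along l,  *)
(* is put to 0; it is killed by the first projector in calH.                  *)
Definition nabla_lower (M : spacetime R m) (Phi : Sigma -> M)
    (l : chart (@half_space R m) M -> Sigma -> 'rV[R]_(1 + m))
    (s : chart (@setT 'rV[R]_m) Sigma) (c : chart (@half_space R m) M)
    (p : Sigma) : 'M[R]_(1 + m) :=
  col_mx 0 (nabla_rigging Phi l s c p *m metric_at Phi c p
              *m (frame Phi l s c p)^T).

(* calH mu nu = proj alpha mu * proj beta nu * nabla_alpha l_beta             *)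
Definition calH (M : spacetime R m) (Phi : Sigma -> M)
    (l : chart (@half_space R m) M -> Sigma -> 'rV[R]_(1 + m))
    (s : chart (@setT 'rV[R]_m) Sigma) (c : chart (@half_space R m) M)
    (p : Sigma) : 'M[R]_(1 + m) :=
  proj^T *m nabla_lower Phi l s c p *m proj.

Variables (Mp Mm : spacetime R m) (Phip : Sigma -> Mp) (Phim : Sigma -> Mm).
Variables (lp : chart (@half_space R m) Mp -> Sigma -> 'rV[R]_(1 + m))
          (lm : chart (@half_space R m) Mm -> Sigma -> 'rV[R]_(1 + m)).
Implicit Types (s : chart (@setT 'rV[R]_m) Sigma) (p : Sigma).
Implicit Types (cp : chart (@half_space R m) Mp).
Implicit Types (cm : chart (@half_space R m) Mm).

Definition same_first_form : Prop :=
  forall s cp cm p, adapted Phip s cp p -> adapted Phim s cm p ->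
    first_form Phip s cp p = first_form Phim s cm p.

Definition rigging_conditions : Prop :=
  [/\ C2_field_along Phip lp /\ C2_field_along Phim lm,
      nowhere_tangent Phip lp /\ nowhere_tangent Phim lm,
      points_inwards Phip lp /\ points_outwards Phim lm,
      (forall cp cm p, atlas cp -> atlas cm ->
         dom cp (Phip p) -> dom cm (Phim p) ->
         rigging_norm Phip lp cp p = rigging_norm Phim lm cm p) &
      (forall s cp cm p, adapted Phip s cp p -> adapted Phim s cm p ->
         rigging_tangent Phip lp s cp p = rigging_tangent Phim lm s cm p)].

Definition jumpH s cp cm p : 'M[R]_(1 + m) :=
  calH Phip lp s cp p - calH Phim lm s cm p.

(* The glued metric on Sigma is taken from the + side; by same_first_form and *)
(* rigging_conditions the - side gives the same matrix.                       *)
Definition singular_einstein s cp cm p : 'M[R]_(1 + m) :=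
  einstein_of_jump (frame_metric Phip lp s cp p) (jumpH s cp cm p).

(* G_ab = e_a^mu e_b^nu G_{mu nu}                                             *)
Definition tangential_einstein s cp cm p : 'M[R]_m :=
  tangent_vecs *m singular_einstein s cp cm p *m tangent_vecs^T.

(* (n, n) does not depend on the charts, which exist around every point, so   *)
(* that quantifying over all charts or over some chart gives the same sets.   *)
Definition Sigma_E : set Sigma :=
  [set p | forall s cp, adapted Phip s cp p ->
             normal_norm (frame_metric Phip lp s cp p) < 0].

Definition Sigma_0 : set Sigma :=
  [set p | forall s cp, adapted Phip s cp p ->
             normal_norm (frame_metric Phip lp s cp p) = 0].

Definition Sigma_L : set Sigma :=
  [set p | forall s cp, adapted Phip s cp p ->
             0 < normal_norm (frame_metric Phip lp s cp p)].

Definition signature_changing_set : set Sigma :=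
  (closure Sigma_L `&` Sigma_0) `|` (closure Sigma_E `&` Sigma_0).

End GluedTangentSpace.

(* Main.v *)
(* In the frame (l, e_1, ..., e_m) the jump J of calH has only tangential      *)
(* components, and G_ab = - (n,n) J_ab - h_ab (n^c n^d J_cd - (n,n) g^cd J_cd).*)
(* The equation G = beta h thus reads - (n,n) J_ab = mu h_ab for a function mu.*)
(* Where (n,n) != 0 this determines both traces of J in terms of mu, and       *)
(* eliminating them gives beta = (1 - m) mu, so that m != 1 and                *)
(*   (m - 1) (n,n) J_ab = G_ab.                                                *)
(* Both sides are continuous, so at a null point in the closure of the         *)
(* non-null points this becomes G_ab = 0, that is h = 0 there. But             *)
(* g^ab h_ab = m - 1 + (n,n) (l,l), which forces m = 1, a contradiction.       *)
Require Import Defs.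
From mathcomp Require Import all_boot all_order all_algebra.
From mathcomp Require Import all_classical all_reals all_analysis.
From mathcomp Require Import ring.
Import Order.TTheory GRing.Theory Num.Theory.
Import numFieldNormedType.Exports.
Local Open Scope classical_set_scope.
Local Open Scope ring_scope.

(** Write J for the jump of calH and N for (n,n) (l,l). If G_ab is a multiple of h_ab, so is - (n,n)
    J_ab, with a factor mu that still contains the two traces of J ([einstein_tangential]).
    Contracting with n^a n^b and with g^ab yields these traces at a non-null point as multiples of
    mu, namely mu (1 - N) and mu (m - 1 + N) ([normal_tangential_metric],
    [trace_tangential_metric]); N cancels in their sum, so beta = (1 - m) mu ([umbilic_jump]).

    The resulting identity (m - 1) (n,n) J_ab = G_ab no longer mentions [beta], an arbitrary
    function about which a limit would say nothing. Its two sides are continuous, since J involves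
    only first derivatives of the C^2 metrics and riggings ([calH_continuous],
    [mx_continuous_einstein]). At a null limit of non-null points it gives G_ab = 0, hence h = 0;
    yet g^ab h_ab = m - 1 there, and m = 1 is excluded by beta = (1 - m) mu at the non-null
    points. *)

(** * Linear algebra of the singular Einstein tensor in the rigged frame *)

Section Algebra.
Context {R : realType} {m : nat}.
Implicit Types (g h : 'M[R]_(1 + m)) (F : 'I_(1 + m) -> 'I_(1 + m) -> R).
Local Notation z := (lshift m (ord0 : 'I_1)).
Local Notation r := (@rshift 1 m).

Lemma lorentzian_sym {g : 'M[R]_(1 + m)} : lorentzian g -> g^T = g.
Proof.
case=> P _ ->; rewrite !trmx_mul trmxK mulmxA; congr (_ *m _ *m _).
by rewrite /Defs.minkowski tr_block_mx !trmx0 raddfN /= !trmx1.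
Qed.

Lemma lorentzian_unit {g : 'M[R]_(1 + m)} : lorentzian g -> g \in unitmx.
Proof.
case=> P PU ->; rewrite !unitmx_mul unitmx_tr PU /= andbT.
have [] // := @mulmx1_unit _ _ (Defs.minkowski R m) (Defs.minkowski R m).
rewrite /Defs.minkowski mulmx_block !mulmx0 !mul0mx !addr0 !add0r mulmx1.
by rewrite mulmxN mulmx1 opprK -scalar_mx_block.
Qed.

Lemma normal_form_delta (j : 'I_(1 + m)) : normal_form R m 0 j = (j == z)%:R.
Proof.
rewrite /normal_form; case: (split_ordP j) => k ->.
  by rewrite row_mxEl (ord1 k) mxE eqxx.
by rewrite row_mxEr mxE eq_rlshift.
Qed.

Lemma normal_vecE g i : normal_vec g i = invmx g i z.
Proof.
rewrite /normal_vec (bigD1 z) //= normal_form_delta eqxx mulr1 big1 ?addr0 //.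
by move=> j /negbTE jz; rewrite normal_form_delta jz mulr0.
Qed.

Lemma normal_normE g : normal_norm g = invmx g z z.
Proof.
rewrite /normal_norm (bigD1 z) //= normal_form_delta eqxx mulr1 normal_vecE.
rewrite big1 ?addr0 // => j /negbTE jz.
by rewrite normal_form_delta jz mulr0.
Qed.

(** Inclusion-exclusion on the row and the column of the rigging index; it reduces tangential
    contractions to full ones, where g and its inverse cancel. *)
Lemma sum_tangential F :
  \sum_a \sum_b F (r a) (r b) =
  \sum_i \sum_j F i j - \sum_j F z j - \sum_i F i z + F z z.
Proof.
rewrite !big_split_ord !big_ord1.
under [X in _ + X - _ - _ + _]eq_bigr => i _ do rewrite big_split_ord big_ord1.
rewrite big_split_ord /= big_ord1 big_split /=; ring.
Qed.

Section Inverse.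
Context {g} (gU : g \in unitmx) (gS : g^T = g).

Let gC i j : g i j = g j i. Proof. by rewrite -{1}gS mxE. Qed.

Let lower_normal i : \sum_j normal_vec g j * g i j = (i == z)%:R.
Proof.
have := mulmxV gU => /matrixP /(_ i z); rewrite !mxE => <-.
by apply: eq_bigr => j _; rewrite normal_vecE mulrC.
Qed.

(** The tangential part of n is n - (n,n) l, because n^0 = (n,n); the formula is its squared
    length. *)
Lemma normal_tangential_metric :
  \sum_a \sum_b normal_vec g (r a) * normal_vec g (r b) * g (r a) (r b) =
  normal_norm g * (normal_norm g * g z z - 1).
Proof.
rewrite (sum_tangential (fun i j => normal_vec g i * normal_vec g j * g i j)).
have row i : \sum_j normal_vec g i * normal_vec g j * g i j
    = normal_vec g i * (i == z)%:R.
  by rewrite -lower_normal mulr_sumr; apply: eq_bigr => j _; rewrite mulrA.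
have -> : \sum_i normal_vec g i * normal_vec g z * g i z
    = \sum_i normal_vec g z * normal_vec g i * g z i.
  by apply: eq_bigr => i _; rewrite gC (mulrC (normal_vec g i)).
under eq_bigr => i _ do rewrite row.
rewrite !(row z) eqxx (bigD1 z) //= big1; last first.
  by move=> i /negbTE ->; rewrite mulr0.
rewrite !normal_vecE normal_normE; ring.
Qed.

(** Each row and each column of the products g^ij g_ij sums to 1. The tangential block of the
    inverse is not the inverse of the tangential block, whence a value other than m. *)
Lemma trace_tangential_metric :
  \sum_a \sum_b invmx g (r a) (r b) * g (r a) (r b) =
  m%:R - 1 + normal_norm g * g z z.
Proof.
rewrite (sum_tangential (fun i j => invmx g i j * g i j)).
have row i : \sum_j invmx g i j * g i j = 1.
  have := mulVmx gU => /matrixP /(_ i i); rewrite !mxE eqxx => e; apply: etrans e.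
  by apply: eq_bigr => j _; rewrite gC.
have col j : \sum_i invmx g i j * g i j = 1.
  have := mulmxV gU => /matrixP /(_ j j); rewrite !mxE eqxx => e; apply: etrans e.
  by apply: eq_bigr => i _; rewrite gC mulrC.
under eq_bigr => i _ do rewrite row.
rewrite row col sumr_const card_ord normal_normE natrD; ring.
Qed.

Lemma einstein_tangential {h} a b :
  einstein_of_jump g h (r a) (r b) =
  - normal_norm g * h (r a) (r b)
  - g (r a) (r b) *
      (\sum_i \sum_j normal_vec g i * normal_vec g j * h i j
       - normal_norm g * trace_of g h).
Proof. by rewrite mxE !normal_form_delta !eq_rlshift !mulr0 mul0r; ring. Qed.

Context {h} (h0r : forall j, h z j = 0) (hr0 : forall i, h i z = 0).

Let sum_jump F : \sum_i \sum_j F i j * h i j =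
  \sum_a \sum_b F (r a) (r b) * h (r a) (r b).
Proof.
rewrite (sum_tangential (fun i j => F i j * h i j)).
rewrite (big1 _ _ (fun j => F z j * h z j)); last first.
  by move=> j _; rewrite h0r mulr0.
rewrite (big1 _ _ (fun j => F j z * h j z)); last first.
  by move=> j _; rewrite hr0 mulr0.
by rewrite h0r; ring.
Qed.

Lemma umbilic_jump {beta} :
    normal_norm g != 0 ->
    (forall a b, einstein_of_jump g h (r a) (r b) = beta * g (r a) (r b)) ->
  exists2 mu, beta = (1 - m%:R) * mu &
    forall a b, - normal_norm g * h (r a) (r b) = mu * g (r a) (r b).
Proof.
move=> nn0 hE.
set Q := \sum_i \sum_j normal_vec g i * normal_vec g j * h i j.
set N := normal_norm g * g z z.
(* All that multiplies g_ab, once the Einstein equation is solved for the term in h_ab. *)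
set mu := beta + Q - normal_norm g * trace_of g h.
have hmu a b : - normal_norm g * h (r a) (r b) = mu * g (r a) (r b).
  by move: (hE a b); rewrite einstein_tangential -/Q /mu mulrBl mulrDl => <-; ring.
(* The jump has no rigging components, so every contraction of it turns into a tangential
   contraction of the metric. *)
have sum_mu F : - normal_norm g * (\sum_i \sum_j F i j * h i j) =
    mu * \sum_a \sum_b F (r a) (r b) * g (r a) (r b).
  rewrite sum_jump !mulr_sumr; apply: eq_bigr => a _.
  rewrite !mulr_sumr; apply: eq_bigr => b _.
  by rewrite mulrCA hmu mulrCA.
have hQ : Q = mu * (1 - N).
  (* Both sides of the contraction with n^a n^b carry a factor (n,n), cancelled here at a non-null
     point. *)
  apply: (mulfI nn0); apply: oppr_inj; rewrite -mulNr /Q.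
  rewrite (sum_mu (fun i j => normal_vec g i * normal_vec g j)).
  by rewrite normal_tangential_metric -/N; ring.
have hT : - normal_norm g * trace_of g h = mu * (m%:R - 1 + N).
  by rewrite /trace_of (sum_mu (fun i j => invmx g i j)) trace_tangential_metric.
exists mu => //.
have : mu = beta + mu * (1 - N) + mu * (m%:R - 1 + N).
  by rewrite -hT -hQ mulNr.
move=> e; rewrite (_ : beta = mu - mu * (1 - N) - mu * (m%:R - 1 + N)).
  by ring.
by rewrite {1}e; ring.
Qed.

End Inverse.
End Algebra.

(** * Pointwise continuity of matrix operations *)

Section MatrixContinuity.
Context {R : realType} {T : topologicalType}.
Implicit Types (x : T).

(** Stated entrywise, so that each operation reduces to finite sums and products of real
    functions. *)
Definition mx_continuous_at {p q} (A : T -> 'M[R]_(p, q)) x : Prop :=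
  forall i j, A y i j @[y --> x] --> A x i j.

Lemma cvg_sum_at {I : finType} (F : I -> T -> R) x :
    (forall i, F i y @[y --> x] --> F i x) ->
  \sum_i F i y @[y --> x] --> \sum_i F i x.
Proof. by move=> cF; apply: cvg_big => //; exact: add_continuous. Qed.

Lemma cvg_prod_at {I : finType} (F : I -> T -> R) x :
    (forall i, F i y @[y --> x] --> F i x) ->
  \prod_i F i y @[y --> x] --> \prod_i F i x.
Proof. by move=> cF; apply: cvg_big => //; exact: mul_continuous. Qed.

Lemma near_eq_cvg_at (f g : T -> R) x :
    (\forall y \near x, f y = g y) ->
  f y @[y --> x] --> f x -> g y @[y --> x] --> g x.
Proof.
move=> fg; rewrite (nbhs_singleton fg) => cf.
by apply: cvg_trans cf; apply: near_eq_cvg.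
Qed.

Lemma near_eq_mx_continuous {p q} (A B : T -> 'M[R]_(p, q)) x :
    (\forall y \near x, A y = B y) ->
  mx_continuous_at A x -> mx_continuous_at B x.
Proof.
move=> AB cA i j; apply: near_eq_cvg_at (cA i j).
by apply: filterS AB => y ->.
Qed.

Lemma mx_continuous_cst {p q} (A : 'M[R]_(p, q)) x :
  mx_continuous_at (fun=> A) x.
Proof. by move=> i j; exact: cvg_cst. Qed.

Lemma mx_continuousD {p q} (A B : T -> 'M[R]_(p, q)) x :
  mx_continuous_at A x -> mx_continuous_at B x ->
  mx_continuous_at (fun y => A y + B y) x.
Proof.
move=> cA cB i j; rewrite mxE; under eq_cvg do rewrite mxE.
exact: cvgD.
Qed.

Lemma mx_continuousN {p q} (A : T -> 'M[R]_(p, q)) x :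
  mx_continuous_at A x -> mx_continuous_at (fun y => - A y) x.
Proof.
move=> cA i j; rewrite mxE; under eq_cvg do rewrite mxE.
exact: cvgN.
Qed.

Lemma mx_continuousM {p q r} (A : T -> 'M[R]_(p, q)) (B : T -> 'M[R]_(q, r)) x :
  mx_continuous_at A x -> mx_continuous_at B x ->
  mx_continuous_at (fun y => A y *m B y) x.
Proof.
move=> cA cB i j; rewrite mxE; under eq_cvg do rewrite mxE.
by apply: cvg_sum_at => k; exact: cvgM.
Qed.

Lemma mx_continuous_tr {p q} (A : T -> 'M[R]_(p, q)) x :
  mx_continuous_at A x -> mx_continuous_at (fun y => (A y)^T) x.
Proof.
by move=> cA i j; rewrite mxE; under eq_cvg do rewrite mxE; exact: cA.
Qed.

Lemma mx_continuous_col {p q r} (A : T -> 'M[R]_(p, r)) (B : T -> 'M[R]_(q, r))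
    x : mx_continuous_at A x -> mx_continuous_at B x ->
  mx_continuous_at (fun y => col_mx (A y) (B y)) x.
Proof.
move=> cA cB i j; case: (split_ordP i) => k ->.
  by rewrite col_mxEu; under eq_cvg do rewrite col_mxEu; exact: cA.
by rewrite col_mxEd; under eq_cvg do rewrite col_mxEd; exact: cB.
Qed.

Lemma cvg_det {n} (A : T -> 'M[R]_n) x :
  mx_continuous_at A x -> \det (A y) @[y --> x] --> \det (A x).
Proof.
move=> cA; apply: cvg_sum_at => s; apply: cvgM; first exact: cvg_cst.
by apply: cvg_prod_at => i; exact: cA.
Qed.

Lemma mx_continuous_inv {n} (A : T -> 'M[R]_n) x :
  A x \in unitmx -> mx_continuous_at A x ->
  mx_continuous_at (fun y => invmx (A y)) x.
Proof.
move=> AxU cA; have det_cvg := cvg_det _ _ cA.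
have detx0 : \det (A x) != 0 by rewrite -unitfE.
(* [invmx] is defined by cases on invertibility; where the determinant is non-zero, hence near x, it
   is given by Cramer's formula. *)
apply: (near_eq_mx_continuous (fun y => (\det (A y))^-1 *: \adj (A y))).
  apply: filterS (cvgr_neq0 _ det_cvg detx0) => y dety0.
  by rewrite /invmx unitmxE unitfE dety0.
move=> i j; rewrite !mxE; under eq_cvg do rewrite !mxE.
apply: cvgM; first exact: cvgV.
apply: cvgM; first exact: cvg_cst.
apply: cvg_det => k l; rewrite !mxE; under eq_cvg do rewrite !mxE.
exact: cA.
Qed.

Context {m : nat}.
Implicit Types (g h : T -> 'M[R]_(1 + m)).

Lemma cvg_normal_vec g x i : g x \in unitmx -> mx_continuous_at g x ->
  normal_vec (g y) i @[y --> x] --> normal_vec (g x) i.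
Proof.
move=> gU cg; rewrite normal_vecE; under eq_cvg do rewrite normal_vecE.
exact: mx_continuous_inv.
Qed.

Lemma cvg_normal_norm g x : g x \in unitmx -> mx_continuous_at g x ->
  normal_norm (g y) @[y --> x] --> normal_norm (g x).
Proof.
move=> gU cg; rewrite normal_normE; under eq_cvg do rewrite normal_normE.
exact: mx_continuous_inv.
Qed.

Lemma mx_continuous_einstein g h x :
    g x \in unitmx -> mx_continuous_at g x -> mx_continuous_at h x ->
  mx_continuous_at (fun y => einstein_of_jump (g y) (h y)) x.
Proof.
move=> gU cg ch i j; rewrite !mxE; under eq_cvg do rewrite !mxE.
have cv k := cvg_normal_vec g x k gU cg.
have cn := cvg_normal_norm g x gU cg.
have ci := mx_continuous_inv _ _ gU cg.
have ct : trace_of (g y) (h y) @[y --> x] --> trace_of (g x) (h x).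
  by apply: cvg_sum_at => k; apply: cvg_sum_at => l; apply: cvgM.
have cc k : \sum_a normal_vec (g y) a * h y a k @[y --> x] -->
    \sum_a normal_vec (g x) a * h x a k.
  by apply: cvg_sum_at => l; apply: cvgM.
have cq : \sum_a \sum_b normal_vec (g y) a * normal_vec (g y) b * h y a b
    @[y --> x] --> \sum_a \sum_b normal_vec (g x) a * normal_vec (g x) b * h x a b.
  apply: cvg_sum_at => k; apply: cvg_sum_at => l; apply: cvgM => //.
  exact: cvgM.
apply: cvgB; last by apply: cvgM => //; apply: cvgB => //; exact: cvgM.
apply: cvgB; last by apply: cvgM => //; exact: cvg_cst.
apply: cvgB; last exact: cvgM.
by apply: cvgD; apply: cvgM => //; exact: cvg_cst.
Qed.

End MatrixContinuity.

(** * Continuity relative to a domain, and charts *)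

Section Differentiability.
Context {R : realType} {n : nat}.
Implicit Types (D : set 'rV[R]_n) (f : 'rV[R]_n -> R).

Lemma Ck_continuous k D f : Ck k D f -> {within D, continuous f}.
Proof. by case: k => [|k] []. Qed.

Lemma Ck_partial k D f i : Ck k.+1 D f -> Ck k D (partial D f i).
Proof. by case=> _ /(_ i) []. Qed.

(** C^k functions are continuous only relative to D, which may contain boundary points of a half
    space; the inner map must therefore approach its limit within D. *)
Lemma cvg_comp_within {T : topologicalType} {D f} {u : T -> 'rV[R]_n} {p : T} :
    {within D, continuous f} -> D (u p) ->
    u @ p --> within D (nbhs (u p)) ->
  f (u q) @[q --> p] --> f (u p).
Proof.
by move=> /subspace_continuousP cf Dup cu; apply: cvg_comp cu _; exact: cf.
Qed.

Lemma coord_within {H : set 'rV[R]_n} {M : topologicalType} {c : chart H M}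
    {p : M} :
  dom c p -> Defs.coord c @ p --> within (img c) (nbhs (Defs.coord c p)).
Proof.
move=> cp A; have dp := open_nbhs_nbhs (conj (dom_open c) cp).
have /subspace_continuousP/(_ _ cp) cc := @coord_cont _ _ _ _ c.
move=> nA; have := cc _ nA; rewrite !nbhs_simpl /= => nA'.
apply: filterS2 dp nA' => q cq; apply => //.
by exists q.
Qed.

End Differentiability.

(** * Invertibility of the frame and continuity of the geometric data on one side *)

Section OneSide.
Context {R : realType} {m : nat}.
Context {Sigma : C3_manifold (@setT 'rV[R]_m)} {M : spacetime R m}.
Context {Phi : Sigma -> M} (emb : C3_embedding Phi).
Context {l : chart (@half_space R m) M -> Sigma -> 'rV[R]_(1 + m)}.
Context (lC2 : C2_field_along Phi l) (lT : nowhere_tangent Phi l).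

Section Adapted.
Context {s : chart (@setT 'rV[R]_m) Sigma} {c : chart (@half_space R m) M}.

Lemma metric_at_lorentzian {p} : adapted Phi s c p ->
  lorentzian (metric_at Phi c p).
Proof. by case=> _ ac _ cp; apply: metric_lorentzian => //; exists (Phi p). Qed.

Lemma frame_unit {p} : adapted Phi s c p -> frame Phi l s c p \in unitmx.
Proof.
move=> ad; have [_ _ _ _ /(_ _ _ _ ad) rf] := emb.
(* The tangents have rank m and the transverse rigging lies outside their span, so the frame has
   rank at least m + 1. *)
have lt : (tangents Phi s c p < frame Phi l s c p)%MS.
  have := submx_refl (frame Phi l s c p).
  rewrite {1}/frame ltmxE !col_mx_sub => /andP[_ ->].
  by rewrite (negbTE (lT _ _ _ ad)).
have : (\rank (tangents Phi s c p) < \rank (frame Phi l s c p))%N.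
  by move: lt; rewrite ltmxErank => /andP[].
by rewrite (eqP rf) -row_free_unit /row_free eqn_leq rank_leq_row.
Qed.

Lemma frame_metric_unit {p} : adapted Phi s c p ->
  frame_metric Phi l s c p \in unitmx.
Proof.
move=> ad; rewrite /frame_metric !unitmx_mul unitmx_tr frame_unit //=.
by rewrite andbT; exact: lorentzian_unit (metric_at_lorentzian ad).
Qed.

Lemma frame_metric_sym {p} : adapted Phi s c p ->
  (frame_metric Phi l s c p)^T = frame_metric Phi l s c p.
Proof.
move=> ad; rewrite /frame_metric !trmx_mul trmxK mulmxA.
by rewrite (lorentzian_sym (metric_at_lorentzian ad)).
Qed.

(** Lets the charts chosen at one point serve at all nearby points. *)
Lemma near_adapted {p} : adapted Phi s c p ->
  \forall q \near p, adapted Phi s c q.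
Proof.
case=> as_ ac sp cp; have [Phi_cont _ _ _ _] := emb.
have ds := open_nbhs_nbhs (conj (dom_open s) sp).
have dc := Phi_cont p _ (open_nbhs_nbhs (conj (dom_open c) cp)).
by apply: filterS2 ds dc => q sq cq; split.
Qed.

Context {p : Sigma} (ad : adapted Phi s c p).

Let local_dom_coord {q} : adapted Phi s c q ->
  local_dom Phi s c (Defs.coord s q).
Proof.
by case=> _ _ sq cq; split; [exists q | rewrite coordK].
Qed.

Let coord_local :
  Defs.coord s @ p --> within (local_dom Phi s c) (nbhs (Defs.coord s p)).
Proof.
move=> A nA; have [_ _ sp _] := ad.
have /subspace_continuousP/(_ _ sp) cc := @coord_cont _ _ _ _ s.
have dp := open_nbhs_nbhs (conj (dom_open s) sp).
have nA' := cc _ nA; apply: filterS3 (near_adapted ad) dp nA' => q adq sq.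
by apply => //; exact: local_dom_coord.
Qed.

Let coord_Phi :
  Defs.coord c \o Phi @ p --> within (img c) (nbhs (Defs.coord c (Phi p))).
Proof.
have [Phi_cont _ _ _ _] := emb; have [_ _ _ cp] := ad.
exact: cvg_comp (Phi_cont p) (coord_within cp).
Qed.

Let img_coord_Phi : img c (Defs.coord c (Phi p)).
Proof. by have [_ _ _ cp] := ad; exists (Phi p). Qed.

Lemma tangents_continuous : mx_continuous_at (tangents Phi s c) p.
Proof.
move=> a j; have [as_ ac sp cp] := ad; rewrite /tangents /jac mxE.
under eq_cvg do rewrite mxE.
apply: (@cvg_comp_within _ _ _ _ (partial _ _ _) (Defs.coord s)) coord_local.
  apply: (Ck_continuous 2); apply: Ck_partial.
  by have [_ _ _ + _] := emb; apply.
exact: local_dom_coord.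
Qed.

Lemma rigging_continuous : mx_continuous_at (l c) p.
Proof.
move=> i j; rewrite (ord1 i).
have [as_ ac sp cp] := ad.
(* Regularity of the rigging is assumed in the coordinates of [s]; near p the chart and its inverse
   cancel. *)
apply: (near_eq_cvg_at (fun q => l c (coordV s (Defs.coord s q)) 0 j)).
  by apply: filterS (near_adapted ad) => q [_ _ sq _]; rewrite coordK.
apply: (@cvg_comp_within _ _ _ _ (fun xi => l c (coordV s xi) 0 j)) coord_local.
  by apply: (Ck_continuous 2); apply lC2.2.
exact: local_dom_coord.
Qed.

Lemma metric_at_continuous : mx_continuous_at (metric_at Phi c) p.
Proof.
move=> i j; have [as_ ac sp cp] := ad.
apply: (@cvg_comp_within _ _ _ _ (fun x => metric c x i j)) coord_Phi => //.
by apply: (Ck_continuous 2); apply: metric_C2.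
Qed.

Lemma frame_continuous : mx_continuous_at (frame Phi l s c) p.
Proof.
by apply: mx_continuous_col; [exact: rigging_continuous|exact: tangents_continuous].
Qed.

Lemma frame_metric_continuous : mx_continuous_at (frame_metric Phi l s c) p.
Proof.
have cf := frame_continuous.
apply: mx_continuousM; last exact: mx_continuous_tr.
by apply: mx_continuousM => //; exact: metric_at_continuous.
Qed.

(** The first partial derivatives of a C^2 metric are continuous up to the boundary, and the inverse
    metric is continuous. *)
Lemma christoffel_continuous mu rho sigma :
  christoffel c (Defs.coord c (Phi q)) mu rho sigma @[q --> p] -->
  christoffel c (Defs.coord c (Phi p)) mu rho sigma.
Proof.
have [as_ ac sp cp] := ad.
have dg i j k : partial (img c) (fun y => metric c y j k) i (Defs.coord c (Phi q))
    @[q --> p] --> partial (img c) (fun y => metric c y j k) i (Defs.coord c (Phi p)).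
  apply: (@cvg_comp_within _ _ _ _ (partial _ _ _)) coord_Phi => //.
  by apply: (Ck_continuous 1); apply: Ck_partial; apply: metric_C2.
rewrite /christoffel; apply: cvgM; first exact: cvg_cst.
apply: cvg_sum_at => nu; apply: cvgM.
  apply: (mx_continuous_inv (metric_at Phi c)); last exact: metric_at_continuous.
  exact: lorentzian_unit (metric_at_lorentzian ad).
by apply: cvgB => //; exact: cvgD.
Qed.

Lemma nabla_rigging_continuous : mx_continuous_at (nabla_rigging Phi l s c) p.
Proof.
have [as_ ac sp cp] := ad; apply: mx_continuousD.
  move=> a j; rewrite mxE; under eq_cvg do rewrite mxE.
  apply: (@cvg_comp_within _ _ _ _ (partial _ _ _) (Defs.coord s)) coord_local.
    by apply: (Ck_continuous 1); apply: Ck_partial; apply lC2.2.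
  exact: local_dom_coord.
move=> a mu; rewrite mxE; under eq_cvg do rewrite mxE.
apply: cvg_sum_at => rho; apply: cvg_sum_at => sigma.
apply: cvgM; last exact: rigging_continuous.
by apply: cvgM; [exact: christoffel_continuous | exact: tangents_continuous].
Qed.

Lemma calH_continuous : mx_continuous_at (calH Phi l s c) p.
Proof.
apply: mx_continuousM; last exact: mx_continuous_cst.
apply: mx_continuousM; first exact: mx_continuous_cst.
apply: mx_continuous_col; first exact: mx_continuous_cst.
apply: mx_continuousM; last exact: mx_continuous_tr frame_continuous.
apply: mx_continuousM; first exact: nabla_rigging_continuous.
exact: metric_at_continuous.
Qed.

End Adapted.
End OneSide.

(** * Tangential and rigging components in the glued frame *)

Section Components.
Context {R : realType} {m : nat}.
Context {Sigma : C3_manifold (@setT 'rV[R]_m)} {M : spacetime R m}.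
Context {Phi : Sigma -> M}.
Context {l : chart (@half_space R m) M -> Sigma -> 'rV[R]_(1 + m)}.
Context {s : chart (@setT 'rV[R]_m) Sigma} {c : chart (@half_space R m) M}.
Local Notation z := (lshift m (ord0 : 'I_1)).
Local Notation r := (@rshift 1 m).

Lemma tangential_components (X : 'M[R]_(1 + m)) a b :
  (tangent_vecs R m *m X *m (tangent_vecs R m)^T) a b = X (r a) (r b).
Proof.
rewrite /tangent_vecs tr_row_mx trmx0 trmx1 -{1}(submxK X) mul_row_block.
by rewrite mul_row_col !mul0mx !mul1mx !add0r mulmx0 add0r mulmx1 !mxE.
Qed.

Lemma frame_metric_tangential p a b :
  frame_metric Phi l s c p (r a) (r b) = first_form Phi s c p a b.
Proof.
by rewrite /frame_metric /frame mul_col_mx tr_col_mx mul_col_row block_mxEdr.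
Qed.

(** The projector annihilates the rigging because n(l) = 1; this is why [calH] has only tangential
    components. *)
Lemma proj_rigging i : Defs.proj R m i z = 0.
Proof.
have rigE : (rigging_vec R m) 0 i = (i == z)%:R := normal_form_delta i.
rewrite !mxE big_ord1 [(rigging_vec R m)^T i _]mxE (_ : ord0 = 0) //.
by rewrite rigE normal_form_delta eqxx mulr1 subrr.
Qed.

Lemma calH_rigging_l p i : calH Phi l s c p z i = 0.
Proof.
rewrite /calH -mulmxA mxE big1 // => j _.
by rewrite mxE proj_rigging mul0r.
Qed.

Lemma calH_rigging_r p i : calH Phi l s c p i z = 0.
Proof. by rewrite /calH mxE big1 // => j _; rewrite proj_rigging mulr0. Qed.

End Components.

(** * The limit at a signature-changing point and the contradiction *)

Theorem theorem2 (R : realType) (m : nat)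
    (Sigma : C3_manifold (@setT 'rV[R]_m)) (Mp Mm : spacetime R m)
    (Phip : Sigma -> Mp) (Phim : Sigma -> Mm)
    (embp : C3_embedding Phip) (embm : C3_embedding Phim)
    (imp : range Phip = @boundary R m Mp)
    (imm : range Phim = @boundary R m Mm)
    (hh : same_first_form Phip Phim)
    (lp : chart (@half_space R m) Mp -> Sigma -> 'rV[R]_(1 + m))
    (lm : chart (@half_space R m) Mm -> Sigma -> 'rV[R]_(1 + m))
    (rig : rigging_conditions Phip Phim lp lm)
    (beta : Sigma -> R) (beta_neq0 : forall p, beta p != 0)
    (hG : forall s cp cm (p : Sigma),
       adapted Phip s cp p -> adapted Phim s cm p ->
       tangential_einstein Phip Phim lp lm s cp cm p
         = beta p *: first_form Phip s cp p) :
  signature_changing_set Phip lp = set0.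
Proof.
have [[lpC2 lmC2] [lpT lmT] _ _ _] := rig.
rewrite -subset0 => p pS.
have [s as_ sp] := atlas_cover p.
have [cp acp cpp] := atlas_cover (Phip p).
have [cm acm cmp] := atlas_cover (Phim p).
have adp : adapted Phip s cp p by [].
have adm : adapted Phim s cm p by [].
pose g q := frame_metric Phip lp s cp q.
pose J q := jumpH Phip Phim lp lm s cp cm q.
pose G q := einstein_of_jump (g q) (J q).
have nn0 : normal_norm (g p) = 0 by case: pS => -[_]; exact.
(* Whether p adheres to the timelike or to the spacelike part, non-null points covered by the same
   charts lie arbitrarily close to it. *)
have near_nonnull (U : set Sigma) : nbhs p U ->
    exists2 q, U q & adapted Phip s cp q /\ adapted Phim s cm q /\
                     normal_norm (g q) != 0.
  move=> pU; have nU : nbhs p [set q | [/\ U q, adapted Phip s cp q &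
      adapted Phim s cm q]].
    by apply: filterS3 pU (near_adapted embp adp) (near_adapted embm adm) => q.
  case: pS => -[/(_ _ nU)[q [qS [Uq ad1 ad2]]] _]; exists q => //;
    (do 2 split => //).
  - by apply: lt0r_neq0; exact: qS.
  - by apply: ltr0_neq0; exact: qS.
have G_tan q a b : adapted Phip s cp q -> adapted Phim s cm q ->
    G q (rshift 1 a) (rshift 1 b) = beta q * g q (rshift 1 a) (rshift 1 b).
  move=> ad1 ad2; rewrite /g frame_metric_tangential.
  have /matrixP/(_ a b) := hG s cp cm q ad1 ad2.
  by rewrite /tangential_einstein tangential_components => e; rewrite [LHS]e mxE.
have J_rig q j : J q (lshift m ord0) j = 0 /\ J q j (lshift m ord0) = 0.
  have subE (A B : 'M[R]_(1 + m)) i k : (A - B) i k = A i k - B i k.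
    by rewrite !mxE.
  by rewrite /J /jumpH !subE !calH_rigging_l !calH_rigging_r subr0.
have umbilic q : adapted Phip s cp q -> adapted Phim s cm q ->
    normal_norm (g q) != 0 -> m%:R != 1 :> R /\ forall a b,
    (m%:R - 1) * normal_norm (g q) * J q (rshift 1 a) (rshift 1 b) =
    G q (rshift 1 a) (rshift 1 b).
  move=> ad1 ad2 nn.
  have [mu betaE hmu] := umbilic_jump
    (frame_metric_unit embp lpT ad1) (frame_metric_sym ad1)
    (fun j => (J_rig q j).1) (fun j => (J_rig q j).2) nn
    (fun a b => G_tan q a b ad1 ad2).
  split.
    apply: contraNneq (beta_neq0 q) => m1.
    by rewrite betaE m1 subrr mul0r.
  move=> a b; rewrite G_tan // betaE -[in RHS]mulrA -[X in _ = _ * X]hmu.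
  by rewrite -/(g q); ring.
have g_cont : mx_continuous_at g p by exact: frame_metric_continuous.
have J_cont : mx_continuous_at J p.
  apply: mx_continuousD; first exact: (calH_continuous embp).
  by apply: mx_continuousN; exact: (calH_continuous embm).
have gU : g p \in unitmx by exact: frame_metric_unit.
have G0 a b : G p (rshift 1 a) (rshift 1 b) = 0.
  (* F vanishes at the non-null points near p. Were F p non-zero, continuity would keep F non-zero
     on a whole neighbourhood, which contains such a point. *)
  pose F q := (m%:R - 1) * normal_norm (g q) * J q (rshift 1 a) (rshift 1 b)
              - G q (rshift 1 a) (rshift 1 b).
  have F_cont : F q @[q --> p] --> F p.
    apply: cvgB; last exact: mx_continuous_einstein.
    apply: cvgM; last exact: J_cont.
    by apply: cvgM; [exact: cvg_cst | exact: cvg_normal_norm].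
  have : F p = 0.
    apply/eqP/negPn/negP => Fp0.
    have [q + [ad1 [ad2 nn]]] := near_nonnull _ (cvgr_neq0 _ F_cont Fp0).
    by rewrite /F /= (umbilic q ad1 ad2 nn).2 subrr eqxx.
  by rewrite /F nn0 mulr0 mul0r sub0r => /eqP; rewrite oppr_eq0 => /eqP.
(* Any one non-null point suffices to exclude m = 1. *)
have [q _ [ad1 [ad2 nn]]] := near_nonnull _ filterT.
have [/eqP m_neq1 _] := umbilic q ad1 ad2 nn.
have := trace_tangential_metric gU (frame_metric_sym adp).
(* At the null point p the trace is m - 1, while all its terms vanish because G_ab = 0 and [beta p]
   is non-zero. *)
rewrite -/(g p) nn0 mul0r addr0 big1 => [/esym/eqP|a _].
  by rewrite subr_eq0 => /eqP.
rewrite big1 // => b _.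
have /eqP := G_tan p a b adp adm.
by rewrite G0 eq_sym mulf_eq0 (negbTE (beta_neq0 p)) => /eqP ->; rewrite mulr0.
Qed.
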